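(* For every $m\geq 5$, $\operatorname{im}(C_m\times P_4)=5$.
   Context: All graphs are finite and simple. $C_m$ is the cycle on $m$ vertices and $P_4$ the path on 4 vertices. A graph $G$ has a $G'$-immersion if there is an injective map $\phi:V(G')\to V(G)$ such that for every edge $uv\in E(G')$ there is a path in $G$ joining $\phi(u)$ and $\phi(v)$, and these paths are pairwise edge-disjoint. The immersion number $\operatorname{im}(G)$ is the largest $t$ such that $G$ has a $K_t$-immersion. The direct product $G\times H$ has vertex set $V(G)\times V(H)$, with $(g,h)$ adjacent to $(g',h')$ iff $gg'\in E(G)$ and $hh'\in E(H)$. *)

(* Defs.v *)
From mathcomp Require Import all_boot.
Set Implicit Arguments.
Unset Strict Implicit.
Unset Printing Implicit Defensive.

Record sgraph := SGraph {
  vertex :> finType;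
  adj : rel vertex;
  adj_sym : symmetric adj;
  adj_irr : irreflexive adj }.

Definition edges (G : sgraph) : {set {set G}} :=
  [set [set u; v] | u in G, v in G & adj u v].

Section CompleteGraph.
Variable t : nat.
Definition complete_adj : rel 'I_t := fun i j => i != j.
Lemma complete_sym : symmetric complete_adj.
Proof. by move=> i j; rewrite /complete_adj eq_sym. Qed.
Lemma complete_irr : irreflexive complete_adj.
Proof. by move=> i; rewrite /complete_adj eqxx. Qed.
Definition complete_graph := SGraph complete_sym complete_irr.
End CompleteGraph.

Section PathGraph.
Variable n : nat.
Definition path_adj : rel 'I_n := fun i j => (i.+1 == j) || (j.+1 == i).
Lemma path_sym : symmetric path_adj.
Proof. by move=> i j; rewrite /path_adj orbC. Qed.
Lemma path_irr : irreflexive path_adj.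
Proof. by move=> i; rewrite /path_adj orbb gtn_eqF. Qed.
Definition path_graph := SGraph path_sym path_irr.
End PathGraph.

Section CycleGraph.
Variable m : nat.
(* The conjunct [i != j] only matters for [m = 1]; the graph is the cycle C_m
   when [3 <= m]. *)
Definition cycle_adj : rel 'I_m :=
  fun i j => (i != j) && ((ordS i == j) || (ordS j == i)).
Lemma cycle_sym : symmetric cycle_adj.
Proof. by move=> i j; rewrite /cycle_adj eq_sym orbC. Qed.
Lemma cycle_irr : irreflexive cycle_adj.
Proof. by move=> i; rewrite /cycle_adj eqxx. Qed.
Definition cycle_graph := SGraph cycle_sym cycle_irr.
End CycleGraph.

Section DirectProduct.
Variables G H : sgraph.
Definition dprod_adj : rel (G * H)%type :=
  fun x y => adj x.1 y.1 && adj x.2 y.2.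
Lemma dprod_sym : symmetric dprod_adj.
Proof. by move=> x y; rewrite /dprod_adj adj_sym (adj_sym x.2). Qed.
Lemma dprod_irr : irreflexive dprod_adj.
Proof. by move=> x; rewrite /dprod_adj adj_irr. Qed.
Definition direct_product := SGraph dprod_sym dprod_irr.
End DirectProduct.

(* A path is the list of its pairwise distinct vertices; paths are undirected,
   so the list may be traversed from [x] to [y] or from [y] to [x]. *)
Definition path_joining (G : sgraph) (x y : G) (s : seq G) : bool :=
  if s is z :: p then
    [&& path (@adj G) z p, uniq (z :: p) & [set z; last z p] == [set x; y]]
  else false.

Definition path_edges (G : sgraph) (s : seq G) : {set {set G}} :=
  if s is z :: p then [set:: pairmap (fun a b : G => [set a; b]) z p] else set0.

(* [P e] is the path of [G] assigned to the edge [e] of [H]; the values of [P]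
   outside [edges H] are irrelevant. *)
Definition has_immersion (G H : sgraph) : Prop :=
  exists (phi : H -> G) (P : {set H} -> seq G),
    [/\ injective phi,
        forall u v : H, adj u v ->
          path_joining (phi u) (phi v) (P [set u; v])
      & {in edges H &, forall e f, e != f ->
          [disjoint path_edges (P e) & path_edges (P f)]}].

Definition is_immersion_number (G : sgraph) (t : nat) : Prop :=
  has_immersion G (complete_graph t) /\
  forall s : nat, has_immersion G (complete_graph s) -> s <= t.

(* Main.v *)
Require Import Defs.
From mathcomp Require Import all_boot.
From mathcomp Require Import zify.
Set Implicit Arguments.
Unset Strict Implicit.
Unset Printing Implicit Defensive.

(** The maximum degree of [C_m x P_4] is 4, which excludes [K_6].

    For the lower bound, put [n = m] if [m] is even and [n = 2m] if [m] is odd,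
    and consider the vertices [(k mod m, r)] with [k + r] odd, where [k] is
    taken mod [n].  Call an edge from column [k] to column [k+1] a step [k] of
    band [b] if it joins rows [b] and [b+1]; each pair [(b, k)] with [b < 3]
    and [k] mod [n] is exactly one edge.  The branch vertices lie in columns
    0, ..., 4 and rows 1 (even columns) and 2 (odd columns).  All paths move
    monotonically through the columns: the seven pairs at distance at most 2
    are joined directly, and the pairs 04, 03, 14 are joined around the cycle,
    the last two paths exchanging bands 1 and 2 in column 5:
<<
      band 0:   02 [0,2)    24 [2,4)    04 [4,n)
      band 1:   01, 12, 23, 34 (one step each)    14 [4,5)    03 [5,n)
      band 2:   13 [1,3)    03 [3,5)    14 [5,n+1)
>>
*)

(** * Immersions of complete graphs *)

Lemma set2_ltn_inj t (i j k l : 'I_t) :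
  i < j -> k < l -> [set i; j] = [set k; l] -> i = k /\ j = l.
Proof.
move=> ij kl E.
have := set21 i j; have := set22 i j; rewrite E !inE.
move=> /orP[]/eqP Ej /orP[]/eqP Ei; subst => //; lia.
Qed.

(** Edges of the complete graph are sets; picking the increasing listing of each one lets the paths
    be indexed by pairs [i < j]. *)
Lemma complete_immersion (G : sgraph) t (phi : 'I_t -> G)
    (Q : 'I_t -> 'I_t -> seq G) :
  injective phi ->
  (forall i j : 'I_t, i < j -> path_joining (phi i) (phi j) (Q i j)) ->
  (forall i j k l : 'I_t, i < j -> k < l -> (i, j) != (k, l) ->
     [disjoint path_edges (Q i j) & path_edges (Q k l)]) ->
  has_immersion G (complete_graph t).
Proof.
move=> phi_inj Qjoin Qdisj.
pose P (e : {set complete_graph t}) :=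
  if [pick p : 'I_t * 'I_t | (p.1 < p.2) && (e == [set p.1; p.2])] is Some p
  then Q p.1 p.2 else [::].
have PE (i j : 'I_t) : i < j -> P [set i; j] = Q i j.
  move=> ij; rewrite /P; case: pickP => [[k l] /= /andP[kl /eqP E]|/(_ (i, j))].
    by have [-> ->] := set2_ltn_inj ij kl E.
  by rewrite /= ij eqxx.
have edgeP (e : {set complete_graph t}) : e \in edges (complete_graph t) ->
    exists i j : 'I_t, i < j /\ e = [set i; j].
  case/imset2P => i j _; rewrite inE /= /complete_adj => nij ->.
  have /orP[ij|ji] : (i < j) || (j < i) by rewrite -neq_ltn.
    by exists i, j.
  by exists j, i; rewrite setUC.
exists phi, P; split => //.
- move=> u v; rewrite /adj /= /complete_adj => nuv.
  have /orP[uv|vu] : (u < v) || (v < u) by rewrite -neq_ltn.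
    by rewrite PE //; apply: Qjoin.
  rewrite setUC PE //; move: (Qjoin _ _ vu).
  by rewrite /path_joining; case: (Q v u) => // z p; rewrite [[set phi u; _]]setUC.
- move=> e f /edgeP[i [j [ij ->]]] /edgeP[k [l [kl ->]]] nef.
  rewrite !PE //; apply: Qdisj => //.
  by apply: contraNneq nef => -[-> ->].
Qed.

(** As [x != y], the path has an edge, and [x] is an end of its first or last one. *)
Lemma path_joining_edge_at (G : sgraph) (x y : G) s :
  x != y -> path_joining x y s ->
  exists z, adj x z /\ [set x; z] \in path_edges s.
Proof.
move=> nxy; case: s => // z p /= /and3P[pth _ /eqP E].
have : x \in [set z; last z p] by rewrite E set21.
rewrite !inE => /orP[]/eqP Ex.
  case: p pth E => [|w p] /=; last first.
    by case/andP=> zw _ _; exists w; rewrite Ex inE mem_head.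
  by move=> _ E; case/eqP: nxy; apply/esym/set1P; rewrite Ex -(setUid [set z]) E set22.
case/lastP: p pth E Ex => [|p w] /=.
  by move=> _ E Ex; case/eqP: nxy; apply/esym/set1P; rewrite Ex -(setUid [set z]) E set22.
rewrite last_rcons rcons_path => /andP[_ lw] _ ->.
exists (last z p); rewrite adj_sym lw inE setUC; split=> //.
by rewrite -cats1 pairmap_cat /= mem_cat mem_seq1 eqxx orbT.
Qed.

(** The [t] paths at one branch vertex are edge-disjoint, so they use distinct edges there. *)
Lemma complete_immersion_degree (G : sgraph) t :
  has_immersion G (complete_graph t.+1) -> exists x : G, t <= #|[set y | adj x y]|.
Proof.
case=> phi [P [phi_inj Pjoin Pdisj]]; exists (phi ord0).
have nb (j : 'I_t.+1) : exists z, (j != ord0) ==>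
    adj (phi ord0) z && ([set phi ord0; z] \in path_edges (P [set ord0; j])).
  have [->|nj] := eqVneq j ord0; first by exists (phi ord0).
  have [||z [az ze]] := @path_joining_edge_at G (phi ord0) (phi j) (P [set ord0; j]).
  - by rewrite (inj_eq phi_inj) eq_sym.
  - by apply: Pjoin; rewrite /adj /= /complete_adj eq_sym.
  - by exists z; rewrite az ze.
pose g j := xchoose (nb j).
have gP j : j != ord0 -> adj (phi ord0) (g j) /\
    [set phi ord0; g j] \in path_edges (P [set ord0; j]).
  by move=> nj; apply/andP/(implyP (xchooseP (nb j))).
have cardC : #|[set~ ord0 : 'I_t.+1]| = t by rewrite cardsC1 card_ord.
rewrite -[leqLHS]cardC -(card_in_imset (f := g)) => [|i j].
  apply: subset_leq_card; apply/subsetP => _ /imsetP[j + ->].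
  by rewrite !inE => /gP[].
rewrite !inE => ni nj E; apply/eqP/negPn/negP => nij.
have [_ gi] := gP _ ni; have [_ gj] := gP _ nj.
have inE0 (k : 'I_t.+1) : k != ord0 -> [set ord0; k] \in edges (complete_graph t.+1).
  by move=> nk; apply: imset2_f; rewrite // inE /= /complete_adj eq_sym.
have ne : [set ord0; i] != [set ord0; j].
  apply: contraNneq nij => Eij; have := set22 ord0 i.
  by rewrite Eij !inE (negPf ni).
have := Pdisj _ _ (inE0 _ ni) (inE0 _ nj) ne.
by move/disjointFr/(_ gi); rewrite E gj.
Qed.

(** * Degrees in the direct product of a cycle and a path *)

Lemma cycle_degree m (i : cycle_graph m) : #|[set j | adj i j]| <= 2.
Proof.
apply: leq_trans (_ : #|[set ordS i; ord_pred i]| <= 2); last first.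
  by rewrite cards2; case: eqP.
apply: subset_leq_card; apply/subsetP => j.
rewrite !inE /= /cycle_adj => /andP[_ /orP[/eqP->|/eqP<-]]; first by rewrite eqxx.
by rewrite ordSK eqxx orbT.
Qed.

Lemma path_degree n (i : path_graph n) : #|[set j | adj i j]| <= 2.
Proof.
rewrite cardE -(size_map val); apply: (@uniq_leq_size _ _ [:: i.+1; i.-1]).
  by rewrite (map_inj_uniq val_inj) enum_uniq.
move=> _ /mapP[j + ->]; rewrite mem_enum !inE /adj /= /path_adj.
by case/orP=> /eqP <-; rewrite ?eqxx ?orbT.
Qed.

Lemma direct_product_degree (G H : sgraph) (x : direct_product G H) :
  #|[set y | adj x y]| = #|[set y | adj x.1 y]| * #|[set y | adj x.2 y]|.
Proof.
by rewrite -cardsX; apply: eq_card => y; rewrite !inE.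
Qed.

(** * Walks through consecutive columns *)

(* [inord] sends every row [r >= 4] to row 0. *)
Definition node m (k r : nat) : direct_product (cycle_graph m.+1) (path_graph 4) :=
  (Ordinal (ltn_pmod k (ltn0Sn m)), inord r).

Lemma node_inj m k l a b : a < 4 -> b < 4 ->
  node m k a = node m l b -> k = l %[mod m.+1] /\ a = b.
Proof. by move=> a4 b4 [-> /(congr1 val)]; rewrite /= !inordK. Qed.

Lemma neqS_mod m k d : d < m -> k + d.+1 <> k %[mod m.+1].
Proof.
move=> dm /eqP; rewrite eqn_mod_dvd ?leq_addr // addKn => /dvdn_leq.
by move/(_ isT); rewrite leqNgt ltnS dm.
Qed.

Lemma adj_node m k a b : 0 < m -> a < 4 -> b < 4 ->
  (a.+1 == b) || (b.+1 == a) -> adj (node m k a) (node m k.+1 b).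
Proof.
move=> m0 a4 b4 ab; rewrite /adj /= /dprod_adj /adj /= /path_adj !inordK // ab andbT.
rewrite /cycle_adj -val_eqE /= eq_sym -{1}addn1; apply/andP; split.
  by apply/eqP/neqS_mod.
by apply/orP; left; rewrite -val_eqE /= -addn1 modnDml addn1.
Qed.

Lemma node_step_inj m k l a b c d : 1 < m -> a < 4 -> b < 4 -> c < 4 -> d < 4 ->
  [set node m k a; node m k.+1 b] = [set node m l c; node m l.+1 d] ->
  [/\ k = l %[mod m.+1], a = c & b = d].
Proof.
move=> m1 a4 b4 c4 d4 E.
have := set21 (node m k a) (node m k.+1 b).
have := set22 (node m k a) (node m k.+1 b).
rewrite E !inE.
case/orP=> /eqP/node_inj[]// E1 E2; case/orP=> /eqP/node_inj[]// E3 E4 //.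
- have : k + 1 = k %[mod m.+1] by rewrite addn1 E1 E3.
  by move/neqS_mod; case; apply: ltnW.
(* The edge is read in opposite directions, which would need a cycle of length at most 2. *)
- have : l + 2 = l %[mod m.+1].
    by rewrite -[RHS]E1 -(addn1 k) -[RHS]modnDml E3 modnDml addn1 addn2.
  by move/neqS_mod; case.
- have : k + 1 = k %[mod m.+1] by rewrite addn1 E1 E3.
  by move/neqS_mod; case; apply: ltnW.
Qed.

(** This is the least common multiple of [m] and 2: modulo it, a column index keeps its parity. *)
Definition period m := if odd m then m.*2 else m.

Lemma period_eq m k l : k = l %[mod m] -> odd k = odd l ->
  k < l + period m -> l < k + period m -> k = l.
Proof.
wlog lk : k l / l <= k => [hw|] E P kl lk'.
  by have [|/ltnW] := leqP l k => h; [apply: hw | apply/esym/hw].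
have /eqP := E; rewrite eqn_mod_dvd // => md.
have ev : ~~ odd (k - l) by rewrite oddB // P addbb.
have : period m %| k - l.
  rewrite /period; case: ifP => // om.
  by rewrite -muln2 Gauss_dvd ?coprimen2 // md dvdn2.
have [/eqP|kl0] := posnP (k - l).
  by rewrite subn_eq0 => kl0 _; apply/eqP; rewrite eqn_leq kl0 lk.
by move/dvdn_leq => /(_ kl0); rewrite leqNgt ltn_subLR // kl.
Qed.

Definition walk m (rho : nat -> nat) s d := [seq node m k (rho k) | k <- iota s d.+1].

Lemma walk_edges m rho s d e : e \in path_edges (walk m rho s d) ->
  exists2 k, s <= k < s + d & e = [set node m k (rho k); node m k.+1 (rho k.+1)].
Proof.
rewrite inE; elim: d s => [//|d IH] s.
rewrite [pairmap _ _ _]/= in_cons => /orP[/eqP->|/IH[k sk ->]].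
  by exists s => //; lia.
by exists k => //; lia.
Qed.

(** If [m.+1] is odd, the walk may go around the cycle almost twice. Its vertices stay distinct
    because the row determines the parity of [k] and [d] is below the period. *)
Lemma walk_joining m rho s d x y :
  0 < m -> d < period m.+1 ->
  (forall k, rho k < 4) -> (forall k, odd (rho k) = ~~ odd k) ->
  (forall k, s <= k < s + d -> ((rho k).+1 == rho k.+1) || ((rho k.+1).+1 == rho k)) ->
  [set node m s (rho s); node m (s + d) (rho (s + d))] = [set x; y] ->
  path_joining x y (walk m rho s d).
Proof.
move=> m0 dn rho4 rhoP rhoS E.
rewrite /walk /path_joining [map _ _]/=; apply/and3P; split.
- clear E dn; elim: d s rhoS => // d IH s rhoS.
  apply/andP; split; first by apply: adj_node => //; apply: rhoS; lia.
  by apply: IH => k sk; apply: rhoS; lia.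
- rewrite -[_ :: _]/(walk m rho s d) map_inj_in_uniq ?iota_uniq // => k l.
  rewrite !mem_iota => sk sl /node_inj[] // kl rkl.
  by apply: period_eq kl _ _ _; [apply/negb_inj; rewrite -!rhoP rkl|lia|lia].
- rewrite (last_map (fun k => node m k (rho k))) -E; apply/eqP; congr [set _; _].
  suff -> : last s (iota s.+1 d) = s + d by [].
  by clear; elim: d s => [|d IH] s /=; rewrite ?addn0 // IH addSnnS.
Qed.

(** * The immersion of the complete graph on five vertices *)

(** Of the two rows of band [b], the one whose sum with [k] is odd. *)
Definition band_row b k := if odd (b + k) then b else b.+1.

(** The change of band at 5 leaves no gap: in column 5, bands 1 and 2 both prescribe row 2. *)
Definition route_row i j k :=
  match i, j with
  | 0, 2 | 2, 4 | 0, 4 => band_row 0 k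
  | 1, 3 => band_row 2 k
  | 0, 3 => band_row (if k <= 5 then 2 else 1) k
  | 1, 4 => band_row (if k <= 5 then 1 else 2) k
  | _, _ => band_row 1 k
  end.

Definition route_start i j :=
  match i, j with 0, 3 => 3 | 0, 4 | 1, 4 => 4 | _, _ => i end.

Definition route_stop n i j :=
  match i, j with 0, 3 | 0, 4 => n | 1, 4 => n.+1 | _, _ => j end.

Definition route m (i j : nat) :=
  walk m (route_row i j) (route_start i j)
    (route_stop (period m.+1) i j - route_start i j).

(** The table of routes read backwards. Disjointness follows from its being a function of band and
    step. *)
Definition step_owner b k :=
  match b with
  | 0 => if k < 2 then (0, 2) else if k < 4 then (2, 4) else (0, 4)
  | 1 => if k < 4 then (k, k.+1) else if k < 5 then (1, 4) else (0, 3)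
  | _ => if k < 3 then (1, 3) else if k < 5 then (0, 3) else (1, 4)
  end.

Lemma route_row_lt4 i j k : route_row i j k < 4.
Proof.
by move: i j => [|[|[|[|[|i]]]]] [|[|[|[|[|j]]]]] /=; rewrite /band_row;
  do ?case: ifP => // _.
Qed.

Lemma odd_route_row i j k : odd (route_row i j k) = ~~ odd k.
Proof.
by move: i j => [|[|[|[|[|i]]]]] [|[|[|[|[|j]]]]] /=; rewrite /band_row;
  case: (leqP k 5) => _ /=; case: (odd k).
Qed.

(** The band of a step is the smaller of its two rows. All steps of one band lie in a common window
    of length [n], which starts at 1 in band 2 because the route 14 runs up to column [n.+1]. *)
Lemma route_step i j n k : i < j < 5 -> 5 < n ->
  route_start i j <= k < route_stop n i j ->
  let a := route_row i j k in let b := route_row i j k.+1 in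
  [/\ (a.+1 == b) || (b.+1 == a), step_owner (minn a b) k = (i, j) &
      (minn a b == 2) <= k < (minn a b == 2) + n].
Proof.
case/andP=> ij j5 n5.
(* These comparisons decide the band at [k] and at [k.+1]. *)
case k5: (k <= 5); case k4: (k < 5); try (exfalso; lia).
all: move: i j ij j5 => [|[|[|[|[|i]]]]] [|[|[|[|[|j]]]]] //= _ _ kn;
  rewrite /band_row ?k5 ?k4 /=; case ok: (odd k); rewrite /minn /=;
  split; rewrite // /step_owner; try lia;
  do ?[case: ifP => ?]; try lia; by congr (_, _); lia.
Qed.

Lemma odd_period m : odd (period m) = false.
Proof. by rewrite /period; case: ifP => //; rewrite odd_double. Qed.

Lemma node_period m k r : node m (period m.+1 + k) r = node m k r.
Proof.
congr (_, _); apply: val_inj => /=.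
by rewrite /period; case: ifP => _; rewrite -?addnn -?addnA ?modnDl.
Qed.

(** Branch vertices in even columns lie in bands 0 and 1, those in odd columns in bands 1 and 2. As
    [n] is even, columns [n] and [n.+1] are columns 0 and 1 again, with the same rows. *)
Lemma route_ends m i j (n := period m.+1) : i < j < 5 -> 5 < n ->
  [set node m (route_start i j) (route_row i j (route_start i j));
       node m (route_stop n i j) (route_row i j (route_stop n i j))] =
  [set node m i (band_row 1 i); node m j (band_row 1 j)].
Proof.
case/andP=> ij j5 n5; have on : odd n = false by apply: odd_period.
have n0 r : node m n r = node m 0 r by rewrite -[n]addn0 node_period.
have n1 r : node m n.+1 r = node m 1 r by rewrite -(addn1 n) node_period.
have n5F : (n <= 5) = false by rewrite leqNgt n5.
have n4F : (n < 5) = false by rewrite ltnNge ltnW.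
by move: i j ij j5 => [|[|[|[|[|i]]]]] [|[|[|[|[|j]]]]] //= _ _;
  rewrite setUC ?n0 ?n1 /band_row ?n5F ?n4F /= on.
Qed.

Lemma route_bounds m i j (n := period m.+1) : i < j < 5 -> 5 < n ->
  route_start i j <= route_stop n i j < route_start i j + n.
Proof.
case/andP; move: i j => [|[|[|[|[|i]]]]] [|[|[|[|[|j]]]]] //= _ _; lia.
Qed.

Lemma period_gt5 m : 4 < m -> 5 < period m.
Proof. by move=> m4; rewrite /period; case: ifP; lia. Qed.

Lemma route_joining m i j : 4 < m.+1 -> i < j < 5 ->
  path_joining (node m i (band_row 1 i)) (node m j (band_row 1 j)) (route m i j).
Proof.
move=> m4 ij; have n5 := period_gt5 m4.
have /andP[st ts] := route_bounds ij n5.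
apply: walk_joining.
- by lia.
- by rewrite ltn_subLR.
- exact: route_row_lt4.
- exact: odd_route_row.
- by rewrite subnKC // => k /(route_step ij n5)[].
- by rewrite subnKC ?route_ends.
Qed.

(** A common edge has one band and one column modulo [m.+1]. Equal rows give equal parity, and the
    window of the band then forces the same step, which has a single owner. *)
Lemma route_disjoint m i j k l : 4 < m.+1 -> i < j < 5 -> k < l < 5 ->
  (i, j) != (k, l) -> [disjoint path_edges (route m i j) & path_edges (route m k l)].
Proof.
move=> m4 ij kl; have n5 := period_gt5 m4.
have /andP[st _] := route_bounds ij n5; have /andP[st' _] := route_bounds kl n5.
apply: contraNT => /pred0Pn[e /= /andP[/walk_edges[u + Eu] /walk_edges[v + Ev]]].
rewrite !subnKC // => /(route_step ij n5)[_ ou u_n] /(route_step kl n5)[_ ov v_n].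
have /node_step_inj[] := etrans (esym Eu) Ev; rewrite ?route_row_lt4 //; first by lia.
move=> uv r r'; apply/eqP; rewrite -ou -ov -r -r'; congr step_owner.
move: v_n; rewrite -r -r' => v_n.
apply: period_eq uv _ _ _; [|lia|lia].
by apply: negb_inj; rewrite -(odd_route_row i j u) -(odd_route_row k l v) r.
Qed.

Theorem theorem27 (m : nat) (hm : 5 <= m) :
  is_immersion_number (direct_product (cycle_graph m) (path_graph 4)) 5.
Proof.
case: m hm => // m m4; split.
  apply: (@complete_immersion _ 5 (fun i => node m i (band_row 1 i)) (route m)).
  - move=> i j /node_inj[]; rewrite /band_row; do ?by case: ifP.
    by rewrite !modn_small ?(leq_trans (ltn_ord _)) // => /val_inj.
  - by move=> i j ij; apply: route_joining => //; rewrite ij ltn_ord.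
  - move=> i j k l ij kl ne; apply: route_disjoint; rewrite ?ij ?kl ?ltn_ord //.
case=> // s /complete_immersion_degree[x].
rewrite direct_product_degree => /leq_trans; apply.
exact: leq_mul (cycle_degree _) (path_degree _).
Qed.
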